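(* Let $(W,\Sigma)$ be a Coxeter system, $Q=(\sigma_1,\ldots,\sigma_n)$ a word in $W$, $\pi\in W$ an element such that $Q$ contains $\pi$, and $\Delta$ the subword complex $\Delta(Q,\pi)$. Let $k$ be a field and $I_\Delta\subset k[x_1,\ldots,x_n]$ the Stanley--Reisner ideal of $\Delta$. Then $$\mathrm{reg}(I_\Delta)\le n-\ell(\pi)+1.$$
   Context: $\Sigma$ is the set of simple reflections of the Coxeter group $W$ and $\ell$ the length function. A word $Q=(\sigma_1,\ldots,\sigma_n)$ of size $n$ is an ordered sequence of elements of $\Sigma$; a subword $P=(\sigma_{i_1},\ldots,\sigma_{i_m})$, $i_1<\cdots<i_m$, is an ordered subsequence (identified with its set of positions $\{i_1,\ldots,i_m\}\subseteq\{1,\ldots,n\}$). $P$ represents $\pi$ if the ordered product of the simple reflections in $P$ is a reduced expression for $\pi$; $P$ contains $\pi$ if some subsequence of $P$ represents $\pi$. The subword complex $\Delta(Q,\pi)$ is the set of subwords $Q\setminus P$ such that $P$ contains $\pi$; it is a pure simplicial complex on (positions) $\{1,\ldots,n\}$ whose facets are the $Q\setminus P$ with $P$ representing $\pi$. The Stanley--Reisner ideal is $I_\Delta=(\prod_{i\in F}x_i: F\subseteq\{1,\ldots,n\},\ F\notin\Delta)$ (not every $i$ need be a vertex of $\Delta$). $\mathrm{reg}$ denotes Castelnuovo--Mumford regularity over $k[x_1,\ldots,x_n]$, i.e. $\mathrm{reg}(M)=\max\{j: \mathrm{Tor}_i(M,k)_{i+j}\ne0\text{ for some }i\}$, with $\mathrm{reg}(0)=-\infty$.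 *)

(* Defs.v *)
From HB Require Import structures.
From mathcomp Require Import all_boot all_order all_algebra.
From mathcomp Require Import mpoly.
From mathcomp Require Import boolp constructive_ereal.

Set Implicit Arguments.
Unset Strict Implicit.
Unset Printing Implicit Defensive.

Import Order.TTheory GRing.Theory Num.Theory.

Section Coxeter.
Local Open Scope group_scope.
Variables (W : groupType) (Sigma : {pred W}).

Definition is_word (w : W) (u : seq W) : Prop :=
  {subset u <= Sigma} /\ \big[*%g/1]_(s <- u) s = w.

(* The value [m s t = 0] encodes m(s, t) = oo: the relation
   [(s * t) ^+ 0 = 1] is then void. Only values on Sigma matter. *)
Definition is_coxeter_matrix (m : W -> W -> nat) : Prop :=
  {in Sigma &, forall s t, m s t = m t s /\ (m s t = 1%N <-> s = t)}.

(* W is the group presented by < Sigma | (s t)^m(s,t) = 1 >: the relations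
   hold in W, Sigma generates W, and every map from Sigma to a group which
   respects the relations extends to W. Words in Sigma suffice for generation,
   since the elements of Sigma are involutions (case s = t). *)
Definition coxeter_system : Prop :=
  exists m : W -> W -> nat,
    [/\ is_coxeter_matrix m,
        forall w, exists u, is_word w u,
        {in Sigma &, forall s t, (s * t) ^+ m s t = 1}
      & forall (G : groupType) (f : W -> G),
          {in Sigma &, forall s t, (f s * f t) ^+ m s t = 1} ->
          exists phi : {multiplicative W -> G}, {in Sigma, phi =1 f}].

Definition has_word_of_size (w : W) (l : nat) : Prop :=
  exists2 u, is_word w u & size u = l.

Definition coxeter_length (w : W) : nat :=
  if pselect (exists l, `[< has_word_of_size w l >]) is left ex_l
  then ex_minn ex_l else 0%N.

Section Subword.
Variables (n : nat) (Q : n.-tuple W).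

(* Subwords of Q are sets of positions; the big product over P enumerates the
   positions in increasing order. *)
Definition represents (P : {set 'I_n}) (w : W) : Prop :=
  \big[*%g/1]_(i in P) tnth Q i = w /\ #|P| = coxeter_length w.

Definition contains (P : {set 'I_n}) (w : W) : Prop :=
  exists2 P' : {set 'I_n}, P' \subset P & represents P' w.

Definition subword_complex (w : W) (F : {set 'I_n}) : Prop :=
  exists2 P : {set 'I_n}, contains P w & F = ~: P.

End Subword.
End Coxeter.

Local Open Scope ring_scope.

Section StanleyReisner.
Variables (k : fieldType) (n : nat).

Definition ideal_generated (G : {mpoly k[n]} -> Prop) (p : {mpoly k[n]}) :
    Prop :=
  exists2 s : seq ({mpoly k[n]} * {mpoly k[n]}),
    (forall cg, cg \in s -> G cg.2) & p = \sum_(cg <- s) cg.1 * cg.2.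

Definition stanley_reisner (Delta : {set 'I_n} -> Prop) :
    {mpoly k[n]} -> Prop :=
  ideal_generated (fun p =>
    exists2 F : {set 'I_n}, ~ Delta F & p = \prod_(i in F) 'X_i).

End StanleyReisner.

Arguments stanley_reisner k {n} Delta _.

Section Regularity.
Variables (k : fieldType) (n : nat).
Local Notation S := {mpoly k[n]}.

Definition homogeneous (d : int) (p : S) : Prop :=
  p = 0 \/ exists2 e : nat, d = e%:Z & p \is e.-homog.

(* A graded free resolution ... -> F_1 -> F_0 -> I -> 0 of an ideal I over S,
   by free modules F_i of finite rank with basis elements of degrees [twist i],
   i.e. F_i is the direct sum of the S(- twist i a). Elements of F_i are row
   vectors, and maps act by right multiplication. *)
Record graded_free_resolution (I : S -> Prop) := GradedFreeResolution {
  rk : nat -> nat;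
  twist : forall i, 'I_(rk i) -> int;
  aug : 'cV[S]_(rk 0);
  diff : forall i, 'M[S]_(rk i.+1, rk i);
  aug_homog : forall a, homogeneous (twist a) (aug a 0);
  diff_homog : forall i a b, homogeneous (twist a - twist b) (diff i a b);
  aug_onto : forall p, I p <-> exists v : 'rV[S]_(rk 0), p = (v *m aug) 0 0;
  exact_aug : forall v : 'rV[S]_(rk 0),
    v *m aug = 0 <-> exists w, v = w *m diff 0;
  exact_diff : forall i (v : 'rV[S]_(rk i.+1)),
    v *m diff i = 0 <-> exists w, v = w *m diff i.+1 }.

Section Tor.
Variables (I : S -> Prop) (F : graded_free_resolution I).

(* The differential of F (x)_S k, where k = S / (x_1, ..., x_n): reduction of
   a polynomial in k is its constant coefficient. *)
Definition diffk i : 'M[k]_(rk F i.+1, rk F i) :=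
  map_mx (fun p : S => p@_0%MM) (diff F i).

Definition in_degree i (j : int) (v : 'rV[k]_(rk F i)) : Prop :=
  forall a, v 0 a != 0 -> twist a = j.

Definition cycle i : 'rV[k]_(rk F i) -> Prop :=
  match i with
  | 0 => fun _ => True
  | i'.+1 => fun v => v *m diffk i' = 0
  end.

Definition boundary i (j : int) (v : 'rV[k]_(rk F i)) : Prop :=
  exists2 w : 'rV[k]_(rk F i.+1), in_degree j w & v = w *m diffk i.

Definition homology_neq0 i (j : int) : Prop :=
  exists v : 'rV[k]_(rk F i), [/\ in_degree j v, cycle v & ~ boundary j v].

End Tor.

(* Tor_i^S(I, k)_j != 0. As Tor does not depend on the resolution, "for some"
   and "for every" graded free resolution amount to the same. *)
Definition Tor_neq0 (I : S -> Prop) (i : nat) (j : int) : Prop :=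
  exists F : graded_free_resolution I, homology_neq0 F i j.

Definition is_max (A : int -> Prop) (r : int) : Prop :=
  A r /\ forall j, A j -> j <= r.

Definition max_ext (A : int -> Prop) : \bar int :=
  match pselect (exists r, is_max A r) with
  | left ex_r => (projT1 (cid ex_r))%:E
  | right _ => if pselect (exists j, A j) then +oo%E else -oo%E
  end.

Definition reg (I : S -> Prop) : \bar int :=
  max_ext (fun j => exists i : nat, Tor_neq0 I i (i%:Z + j)).

End Regularity.

(* Main.v *)
(* Only one property of the subword complex matters: its faces have at most
   n - l(pi) elements. For every complex whose faces have at most d elements,
   reg (I_Delta) <= d + 1. Removing a vertex x gives an exact sequence
   0 -> I_del(-1) -> I_del (+) I_link(-1) -> I_Delta -> 0, where the faces of
   the link have at most d - 1 elements, so by induction on the vertex set an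
   iterated mapping cone resolves I_Delta with all degrees at most i + d + 1 in
   homological degree i. An arbitrary graded free resolution F is compared with
   this one: its identity is homotopic to a map factoring through the cone, and
   the factorization vanishes modulo the variables in degrees above
   i + d + 1. *)
Require Import Defs.
From HB Require Import structures.
From mathcomp Require Import all_boot all_order all_algebra.
From mathcomp Require Import mpoly.
From mathcomp Require Import boolp constructive_ereal.
From mathcomp Require Import zify.

Set Implicit Arguments.
Unset Strict Implicit.
Unset Printing Implicit Defensive.

Import Order.TTheory GRing.Theory Num.Theory.

Local Open Scope ring_scope.

(** * Matrices chosen row by row, and case analysis on ['I_(p + q)] *)

Lemma rows_exist (R : Type) (m p : nat) (P : 'I_m -> 'rV[R]_p -> Prop) :
  (forall a, exists w, P a w) ->
  exists M : 'M[R]_(m, p), forall a, P a (row a M).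
Proof.
move=> /fin_all_exists [f Pf]; exists (\matrix_a f a) => a.
by have -> : row a (\matrix_a f a) = f a by apply/rowP => j; rewrite !mxE.
Qed.

Definition case_split T p q (f : 'I_p -> T) (g : 'I_q -> T)
    (s : 'I_(p + q)) : T :=
  match split s with inl a => f a | inr b => g b end.

Lemma case_splitl T p q (f : 'I_p -> T) (g : 'I_q -> T) a :
  case_split f g (lshift q a) = f a.
Proof. by rewrite /case_split -[lshift q a]/(unsplit (inl a)) unsplitK. Qed.

Lemma case_splitr T p q (f : 'I_p -> T) (g : 'I_q -> T) b :
  case_split f g (rshift p b) = g b.
Proof. by rewrite /case_split -[rshift p b]/(unsplit (inr b)) unsplitK. Qed.

Definition case_splitE := (case_splitl, case_splitr).

Section Resolutions.
Variables (k : fieldType) (n : nat).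
Local Notation S := {mpoly k[n]}.
Implicit Types (p q : S) (I : S -> Prop).

(** * Homogeneous parts of polynomials *)

Definition mfilter (P : pred 'X_{1..n}) p : S :=
  \sum_(m <- msupp p | P m) p@_m *: 'X_[m].

Lemma mcoeff_mfilter P p m : (mfilter P p)@_m = if P m then p@_m else 0.
Proof.
rewrite /mfilter raddf_sum /=.
under eq_bigr do rewrite mcoeffZ mcoeffX.
case: ifP => Pm; last first.
  rewrite big1_seq // => j /andP[Pj _].
  case: eqP => [jm|]; last by rewrite mulr0.
  by rewrite jm Pm in Pj.
have [mp|mNp] := boolP (m \in msupp p).
  rewrite (big_rem m) //= Pm eqxx mulr1 big1_seq ?addr0 // => j /andP[_].
  by rewrite mem_rem_uniq // inE => /andP[/negPf -> _]; rewrite mulr0.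
rewrite (memN_msupp_eq0 mNp) big1_seq // => j /andP[_ jp].
by case: eqP => [jm|]; rewrite ?mulr0 // -jm jp in mNp *.
Qed.

Lemma mpoly_neq0P p : reflect (exists m, p@_m != 0) (p != 0).
Proof.
apply: (iffP idP) => [p0|[m pm]]; last first.
  by apply: contraNneq pm => ->; rewrite mcoeff0.
by exists (mlead p); rewrite mleadc_eq0.
Qed.

(** Quantifying over nonzero coefficients makes the case [p = 0] vacuous, so degrees can be tracked
    monomial by monomial. *)
Lemma homogeneousP d p :
  homogeneous d p <-> forall m, p@_m != 0 -> (mdeg m)%:Z = d.
Proof.
split=> [[->|[e -> /dhomogP hp]] m|hp]; first by rewrite mcoeff0 eqxx.
  by rewrite -mcoeff_msupp => /hp ->.
have [->|/mpoly_neq0P[m pm]] := eqVneq p 0; [by left|right].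
exists (mdeg m); first by rewrite (hp m pm).
by apply/dhomogP => j; rewrite mcoeff_msupp => /hp; rewrite -(hp m pm) => -[].
Qed.

(* A graded free resolution whose terms are collected in a single free module:
   the [a]-th basis element has homological degree [hdeg a] and degree
   [tdeg a]. *)
Record total_resolution I := TotalResolution {
  trk : nat;
  hdeg : 'I_trk -> nat;
  tdeg : 'I_trk -> int;
  teps : 'cV[S]_trk;
  tdiff : 'M[S]_trk;
  teps_deg : forall a m, (teps a 0)@_m != 0 ->
    hdeg a = 0%N /\ tdeg a = (mdeg m)%:Z;
  tdiff_deg : forall a b m, (tdiff a b)@_m != 0 ->
    hdeg a = (hdeg b).+1 /\ tdeg a = (mdeg m)%:Z + tdeg b;
  tdiff_eps : tdiff *m teps = 0;
  tdiff_sq : tdiff *m tdiff = 0;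
  teps_onto : forall p, I p <-> exists v : 'rV[S]_trk, p = (v *m teps) 0 0;
  texact : forall v : 'rV[S]_trk, v *m tdiff = 0 -> v *m teps = 0 ->
    exists w, v = w *m tdiff }.

(** * Bihomogeneous elements of a total resolution *)

Section Graded.
Variables (I : S -> Prop) (G : total_resolution I).
Local Notation N := (trk G).

Definition bihomog (i : nat) (e : int) (v : 'rV[S]_N) : Prop :=
  forall b m, (v 0 b)@_m != 0 -> hdeg b = i /\ (mdeg m)%:Z + tdeg b = e.

Definition bpart (i : nat) (e : int) (v : 'rV[S]_N) : 'rV[S]_N :=
  \row_b mfilter
    (fun m => (hdeg b == i) && ((mdeg m)%:Z + tdeg b == e)) (v 0 b).

Lemma bpartP i e v : bihomog i e (bpart i e v).
Proof.
move=> b m; rewrite mxE mcoeff_mfilter.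
by case: ifP => [/andP[/eqP -> /eqP ->]|_] //; rewrite eqxx.
Qed.

Lemma bpart_id i e v : bihomog i e v -> bpart i e v = v.
Proof.
move=> hv; apply/rowP => b; rewrite mxE; apply/mpolyP => m.
rewrite mcoeff_mfilter; have [->|vm] := eqVneq (v 0 b)@_m 0; first by case: ifP.
by case: (hv _ _ vm) => -> ->; rewrite !eqxx.
Qed.

(** [tdiff] lowers the homological degree by one and preserves the degree, so it commutes with
    taking components. *)
Lemma bpart_diff i e v : bpart i e (v *m tdiff G) = bpart i.+1 e v *m tdiff G.
Proof.
apply/rowP => b; rewrite !mxE; apply/mpolyP => m.
rewrite mcoeff_mfilter; case: ifP => hbm; rewrite !raddf_sum;
  [apply: eq_bigr => a _|apply/esym/big1 => a _];
  rewrite /= !mcoeffM; [apply: eq_bigr|apply: big1] => j /eqP mj;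
  rewrite mxE mcoeff_mfilter;
  (have [->|/tdiff_deg[ha ta]] := eqVneq (tdiff G a b)@_(j.2) 0;
    first by rewrite !mulr0).
all: rewrite (congr1 mdeg mj) mdegD PoszD -addrA -ta in hbm.
all: by rewrite ha eqSS hbm ?mul0r.
Qed.

Lemma bpart_eps e v :
  bpart 0 e v *m teps G =
    const_mx (mfilter (fun m => (mdeg m)%:Z == e) ((v *m teps G) 0 0)).
Proof.
apply/rowP => b; rewrite !mxE !ord1 {b}; apply/mpolyP => m.
rewrite mcoeff_mfilter; case: ifP => hbm; rewrite !raddf_sum;
  [apply: eq_bigr => a _|apply: big1 => a _];
  rewrite /= !mcoeffM; [apply: eq_bigr|apply: big1] => j /eqP mj;
  rewrite mxE mcoeff_mfilter;
  (have [->|/teps_deg[ha ta]] := eqVneq (teps G a 0)@_(j.2) 0;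
    first by rewrite !mulr0).
all: rewrite (congr1 mdeg mj) mdegD PoszD -ta in hbm.
all: by rewrite ha eqxx hbm ?mul0r.
Qed.

Lemma bihomog_eps0 i e v : bihomog i.+1 e v -> v *m teps G = 0.
Proof.
move=> hv; apply/rowP => b; rewrite !mxE !ord1 big1 // => a _.
have [->|/mpoly_neq0P[m /hv[ha _]]] := eqVneq (v 0 a) 0; first by rewrite mul0r.
have [->|/mpoly_neq0P[j /teps_deg[ha0 _]]] := eqVneq (teps G a 0) 0.
  by rewrite mulr0.
by rewrite ha in ha0.
Qed.

Lemma bihomog_diff0 e v : bihomog 0 e v -> v *m tdiff G = 0.
Proof.
move=> hv; apply/rowP => b; rewrite !mxE big1 // => a _.
have [->|/mpoly_neq0P[m /hv[ha _]]] := eqVneq (v 0 a) 0; first by rewrite mul0r.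
have [->|/mpoly_neq0P[j /tdiff_deg[ha0 _]]] := eqVneq (tdiff G a b) 0.
  by rewrite mulr0.
by rewrite ha in ha0.
Qed.

(** Any preimage of [v] under [tdiff] may be replaced by its component of bidegree [(i.+1, e)], by
    [bpart_diff]. *)
Lemma texact_graded i e v : bihomog i e v ->
    v *m tdiff G = 0 -> v *m teps G = 0 ->
  exists2 w, bihomog i.+1 e w & w *m tdiff G = v.
Proof.
move=> hv vD ve; have [w vw] := texact vD ve; exists (bpart i.+1 e w).
  exact: bpartP.
by rewrite -bpart_diff -vw bpart_id.
Qed.

Lemma teps_onto_graded e p : I p -> homogeneous e p ->
  exists2 w, bihomog 0 e w & (w *m teps G) 0 0 = p.
Proof.
move=> /(teps_onto G)[w ->] /homogeneousP hp; exists (bpart 0 e w).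
  exact: bpartP.
rewrite bpart_eps mxE; apply/mpolyP => m; rewrite mcoeff_mfilter.
case: ifP => // /negbT hm; apply/esym/eqP; apply: contraNT hm => /hp ->.
exact: eqxx.
Qed.

Lemma teps_homog a : homogeneous (tdeg a) (teps G a 0).
Proof. by apply/homogeneousP => m /teps_deg[_ ->]. Qed.

Lemma teps_mem a : I (teps G a 0).
Proof. by apply/(teps_onto G); exists (delta_mx 0 a); rewrite -rowE mxE. Qed.

End Graded.

(** Each monomial of [u 0 b] adds its degree to that of row [b], so the bidegree of a row is
    prescribed only where [u] has a nonzero coefficient. *)
Lemma bihomog_mulmx I (G : total_resolution I) (p : nat) (u : 'rV[S]_p)
    (f : 'M[S]_(p, trk G)) i e :
  (forall b m, (u 0 b)@_m != 0 -> bihomog i (e - (mdeg m)%:Z) (row b f)) ->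
  bihomog i e (u *m f).
Proof.
move=> uf s m; rewrite mxE raddf_sum /= => nz.
have [b {}nz] : exists b, (u 0 b * f b s)@_m != 0.
  apply/existsP; apply: contraNT nz; rewrite negb_exists => /forallP z.
  by rewrite big1 // => b _; apply/eqP; move: (z b); rewrite negbK.
rewrite mcoeffM in nz.
have [j /eqP mj {}nz] : exists2 j : 'X_{1..n < (mdeg m).+1, (mdeg m).+1},
    m == (j.1 + j.2)%MM & (u 0 b)@_j.1 * (f b s)@_j.2 != 0.
  apply/exists_inP; apply: contraNT nz; rewrite negb_exists_in => /forall_inP z.
  by rewrite big1 // => j /z; rewrite negbK => /eqP.
move: nz; rewrite mulf_eq0 negb_or => /andP[/uf/(_ s j.2)].
rewrite mxE => us /us[-> ts]; split=> //.
by rewrite (congr1 mdeg mj) mdegD PoszD -addrA ts addrC subrK.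
Qed.

(** * Comparison of an arbitrary graded free resolution with a total one *)

Section Comparison.
Variables (I : S -> Prop).
Variables (F : graded_free_resolution I) (G : total_resolution I).
Local Notation N := (trk G).
Local Notation red := (map_mx (mcoeff 0%MM : S -> k)).

Lemma diff_aug : diff F 0 *m aug F = 0.
Proof.
apply/row_matrixP => a; rewrite row0 row_mul; apply/exact_aug.
by exists (delta_mx 0 a); rewrite rowE.
Qed.

Lemma diff_sq i : diff F i.+1 *m diff F i = 0.
Proof.
apply/row_matrixP => a; rewrite row0 row_mul; apply/exact_diff.
by exists (delta_mx 0 a); rewrite rowE.
Qed.

Lemma exact_aug_mx (p : nat) (M : 'M_(p, rk F 0)) :
  M *m aug F = 0 -> exists H, H *m diff F 0 = M.
Proof.
move=> M0.
have [|H HM] := @rows_exist S p _ (fun a w => w *m diff F 0 = row a M).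
  move=> a; have [|w ->] := (exact_aug (g := F) (row a M)).1; last by exists w.
  by rewrite -row_mul M0 row0.
by exists H; apply/row_matrixP => a; rewrite row_mul HM.
Qed.

Lemma exact_diff_mx i (p : nat) (M : 'M_(p, rk F i.+1)) :
  M *m diff F i = 0 -> exists H, H *m diff F i.+1 = M.
Proof.
move=> M0.
have [|H HM] := @rows_exist S p _ (fun a w => w *m diff F i.+1 = row a M).
  move=> a; have [|w ->] := (exact_diff (g := F) (row a M)).1; last by exists w.
  by rewrite -row_mul M0 row0.
by exists H; apply/row_matrixP => a; rewrite row_mul HM.
Qed.

(** One step of the comparison theorem: the rows of [diff F i *m f] are bihomogeneous cycles, and
    exactness of [G] lifts each of them in its degree. *)
Lemma lift_to_total i (f : 'M_(rk F i, N)) :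
    (forall a, bihomog i (twist a) (row a f)) ->
    diff F i *m f *m tdiff G = 0 -> diff F i *m f *m teps G = 0 ->
  exists2 f' : 'M_(rk F i.+1, N), f' *m tdiff G = diff F i *m f
    & forall a, bihomog i.+1 (twist a) (row a f').
Proof.
move=> fh fD fe; pose P a w := bihomog i.+1 (twist a) w /\
  w *m tdiff G = row a (diff F i *m f).
have [a|f' f'P] := @rows_exist S (rk F i.+1) N P.
  have [|||w wh wD] := @texact_graded _ G i (twist a) (row a (diff F i *m f)).
  - rewrite row_mul; apply: bihomog_mulmx => b m; rewrite mxE => nz.
    have /homogeneousP/(_ _ nz) -> := diff_homog (g := F) a b.
    by rewrite opprB addrC subrK.
  - by rewrite -row_mul fD row0.
  - by rewrite -row_mul fe row0.
  by exists w.
exists f' => [|a]; last by have [] := f'P a.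
by apply/row_matrixP => a; rewrite row_mul; have [] := f'P a.
Qed.

(* [f] and [g] are the components in homological degree [i] of comparison maps
   between [F] and [G], and [h] that of a homotopy from [f *m g] to the
   identity; the homotopy in degree [i - 1] only shows in the last clause. *)
Lemma comparison i :
  exists f : 'M_(rk F i, N), exists g : 'M_(N, rk F i),
  exists h : 'M_(rk F i, rk F i.+1),
  [/\ forall a, bihomog i (twist a) (row a f),
      diff F i *m f *m tdiff G = 0 /\ diff F i *m f *m teps G = 0,
      exists g', g' *m diff F i = tdiff G *m g,
      diff F i *m (1%:M - f *m g - h *m diff F i) = 0
    & forall z : 'rV[k]_(rk F i), Defs.cycle z ->
        z *m red (1%:M - f *m g - h *m diff F i) = 0].
Proof.
elim: i => [|i [f [g [h [fh [fD fe] [g' g'E] hE _]]]]].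
  pose P a (w : 'rV_N) := bihomog 0 (twist a) w /\ w *m teps G = row a (aug F).
  have [a|f fP] := @rows_exist S (rk F 0) N P.
    have Ia : I (aug F a 0).
      by apply/(aug_onto F); exists (delta_mx 0 a); rewrite -rowE mxE.
    have [w wh we] := teps_onto_graded G Ia (aug_homog (g := F) a).
    by exists w; split=> //; apply/rowP => b; rewrite !ord1 we mxE.
  pose P' a (w : 'rV_(rk F 0)) := w *m aug F = row a (teps G).
  have [a|g gP] := @rows_exist S N _ P'.
    have [w we] := (aug_onto F _).1 (teps_mem a).
    by exists w; apply/rowP => b; rewrite !ord1 -we mxE.
  have fe : f *m teps G = aug F.
    by apply/row_matrixP => a; rewrite row_mul; have [] := fP a.
  have ge : g *m aug F = teps G by apply/row_matrixP => a; rewrite row_mul gP.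
  have fh a : bihomog 0 (twist a) (row a f) by have [] := fP a.
  have fD : f *m tdiff G = 0.
    by apply/row_matrixP => a; rewrite row_mul row0 (bihomog_diff0 (fh a)).
  (* [f *m g] and the identity have the same composite with [aug F], so their difference factors
     through [diff F 0]. *)
  have [|h hE] := @exact_aug_mx _ (1%:M - f *m g).
    by rewrite mulmxBl mul1mx -mulmxA ge fe subrr.
  exists f, g, h; split=> //.
  - by rewrite -!mulmxA fD mulmx0 fe diff_aug.
  - by apply: exact_aug_mx; rewrite -mulmxA ge tdiff_eps.
  - by rewrite hE subrr mulmx0.
  - by move=> z _; rewrite hE subrr map_mx0 mulmx0.
have [f' f'D f'h] := lift_to_total fh fD fe.
(* Multiplied by [diff F i], this matrix becomes [diff F i *m (1%:M - f *m g - h *m diff F i)],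
   which is zero by [hE]. *)
have [|h' h'E] := @exact_diff_mx i _ (1%:M - f' *m g' - diff F i *m h).
  rewrite !mulmxBl mul1mx -[f' *m g' *m _]mulmxA g'E mulmxA f'D.
  by move: hE; rewrite !mulmxBr mulmx1 !mulmxA.
have f'gE : 1%:M - f' *m g' - h' *m diff F i.+1 = diff F i *m h.
  by rewrite h'E opprB addrC subrK.
exists f', g', h'; split=> //.
- split; first by rewrite -mulmxA f'D mulmxA diff_sq mul0mx.
  rewrite -mulmxA; suff -> : f' *m teps G = 0 by rewrite mulmx0.
  by apply/row_matrixP => a; rewrite row_mul row0 (bihomog_eps0 (f'h a)).
- by apply: exact_diff_mx; rewrite -mulmxA g'E mulmxA tdiff_sq mul0mx.
- by rewrite f'gE mulmxA diff_sq mul0mx.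
(* The remainder factors through [diff F i], whose reduction annihilates cycles. *)
- move=> z; rewrite f'gE map_mxM mulmxA /= => zd.
  by rewrite [z *m _]zd mul0mx.
Qed.

(** By [comparison], a cycle [z] is [z *m red f *m red g] plus a boundary; the first term passes
    through [G] and vanishes for degree reasons. *)
Lemma homology_vanish (r : int) i j :
    (forall b : 'I_N, tdeg b <= (hdeg b)%:Z + r) -> i%:Z + r < j ->
  ~ homology_neq0 F i j.
Proof.
move=> Gr ij [z [zj zc]]; apply.
have [f [g [h [fh _ _ _ /(_ z zc)]]]] := comparison i.
rewrite !map_mxB map_mx1 !map_mxM !mulmxBr mulmx1 !mulmxA.
(* A nonzero constant entry of [f] in a row where [z] is nonzero would give a basis element of [G]
   of homological degree [i] and degree [j], against [i%:Z + r < j]. *)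
have -> : z *m red f = 0.
  apply/rowP => s; rewrite !mxE big1 // => a _.
  have [->|za] := eqVneq (z 0 a) 0; first by rewrite mul0r.
  rewrite mxE; have [->|fa] := eqVneq (f a s)@_0%MM 0; first by rewrite mulr0.
  have [|hs ts] := fh a s 0%MM; first by rewrite mxE.
  move: (Gr s) ij; rewrite hs -(zj _ za) -ts mdeg0 add0r.
  move=> le /(le_lt_trans le).
  by rewrite ltxx.
rewrite mul0mx subr0 => /eqP; rewrite subr_eq0 => /eqP zE.
move: (z *m red h) zE => w zE; have {}zE : z = w *m diffk F i := zE.
(* [w] need not be homogeneous. Its part of degree [j] suffices, since nonzero constant entries of
   the differential join basis elements of equal twist. *)
exists (\row_b if twist b == j then w 0 b else 0).
  by move=> b; rewrite mxE; case: ifP => [/eqP ->|_] //; rewrite eqxx.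
apply/rowP => c; rewrite {1}zE !mxE.
have dk b : (diff F i b c)@_0%MM != 0 -> twist b = twist c.
  have /homogeneousP dh := diff_homog (g := F) b c.
  by move/dh; rewrite mdeg0 => /esym/eqP; rewrite subr_eq0 => /eqP.
have [cj|cj] := eqVneq (twist c) j.
  apply: eq_bigr => b _; rewrite !mxE.
  have [->|/dk ->] := eqVneq (diff F i b c)@_0%MM 0; first by rewrite !mulr0.
  by rewrite cj eqxx.
transitivity (z 0 c); first by rewrite zE mxE.
transitivity (0 : k); first by apply: contra_neq_eq cj => /zj.
rewrite big1 // => b _; rewrite !mxE.
have [->|/dk ->] := eqVneq (diff F i b c)@_0%MM 0; first by rewrite !mulr0.
by rewrite (negPf cj) mul0r.
Qed.

End Comparison.

(** * Chain maps between total resolutions *)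

Lemma total_lift (I1 I2 : S -> Prop)
    (G1 : total_resolution I1) (G2 : total_resolution I2) :
    (forall p, I1 p -> I2 p) ->
  exists phi : 'M_(trk G1, trk G2),
    [/\ forall a, bihomog (hdeg a) (tdeg a) (row a phi),
        phi *m teps G2 = teps G1 & phi *m tdiff G2 = tdiff G1 *m phi].
Proof.
move=> I12.
(* Induction on homological degree: [phi] respects degrees and augmentations throughout, but is a
   chain map only on basis elements with [hdeg a <= i]. As the rank is finite, a large [i]
   suffices. *)
suff: forall i, exists phi : 'M_(trk G1, trk G2),
    [/\ forall a, bihomog (hdeg a) (tdeg a) (row a phi),
        phi *m teps G2 = teps G1
      & forall a, (hdeg a <= i)%N ->
        row a phi *m tdiff G2 = row a (tdiff G1) *m phi].
  move=> /(_ (\max_(a < trk G1) hdeg a)%N)[phi [phih phie phiD]].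
  exists phi; split=> //; apply/row_matrixP => a; rewrite !row_mul phiD //.
  exact: leq_bigmax.
have D0 a b : (hdeg a <= hdeg b)%N -> tdiff G1 a b = 0.
  move=> ab; apply: contraTeq ab => /mpoly_neq0P[m /tdiff_deg[-> _]].
  by rewrite -ltnNge.
have e0 a : (0 < hdeg a)%N -> teps G1 a 0 = 0.
  by apply: contraTeq => /mpoly_neq0P[m /teps_deg[-> _]].
elim=> [|i [phi [phih phie phiD]]].
  pose P a (w : 'rV_(trk G2)) :=
    bihomog (hdeg a) (tdeg a) w /\ w *m teps G2 = row a (teps G1).
  have [a|phi phiP] := @rows_exist S (trk G1) _ P.
    have [a0|a_gt0] := posnP (hdeg a).
      have [w wh we] := teps_onto_graded G2 (I12 _ (teps_mem a)) (teps_homog a).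
      by exists w; split; rewrite ?a0 //; apply/rowP => b; rewrite !ord1 we mxE.
    exists 0; split; first by move=> b m; rewrite mxE mcoeff0 eqxx.
    by rewrite mul0mx; apply/rowP => b; rewrite !ord1 !mxE e0.
  exists phi; split=> [a||a]; first by have [] := phiP a.
    by apply/row_matrixP => a; rewrite row_mul; have [] := phiP a.
  rewrite leqn0 => /eqP a0.
  have [] := phiP a; rewrite a0 => /bihomog_diff0 -> _.
  suff -> : row a (tdiff G1) = 0 by rewrite mul0mx.
  by apply/rowP => b; rewrite !mxE D0 // a0.
(* Rows of homological degree [i.+1] are chosen anew as lifts; those of degree at most [i] are
   kept. *)
pose P a w := [/\ bihomog (hdeg a) (tdeg a) w, w *m teps G2 = row a (teps G1),
  (hdeg a <= i)%N -> w = row a phi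
  & hdeg a = i.+1 -> w *m tdiff G2 = row a (tdiff G1) *m phi].
have [a|psi psiP] := @rows_exist S (trk G1) _ P.
  have [ai|ai] := eqVneq (hdeg a) i.+1; last first.
    exists (row a phi); split; rewrite -?row_mul ?phie // => /eqP.
    by rewrite (negPf ai).
  have [|||w wh wD] := @texact_graded _ G2 i (tdeg a) (row a (tdiff G1) *m phi).
  - apply: bihomog_mulmx => b m; rewrite mxE => /tdiff_deg[hb tb].
    by move: (phih b); rewrite tb addrC addKr; move: hb; rewrite ai => -[->].
  - have -> : row a (tdiff G1) *m phi *m tdiff G2
        = row a (tdiff G1) *m (tdiff G1 *m phi).
      rewrite -mulmxA; apply/rowP => c; rewrite !mxE; apply: eq_bigr => b _.
      rewrite mxE; have [bi|bi] := leqP (hdeg b) i.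
        move/rowP/(_ c): (phiD b bi); rewrite -row_mul !mxE => ->.
        by congr (_ * _); apply: eq_bigr => ? _; rewrite mxE.
      by rewrite D0 ?mul0r // ai.
    by rewrite mulmxA -row_mul tdiff_sq row0 mul0mx.
  - by rewrite -mulmxA phie -row_mul tdiff_eps row0.
  exists w; split; rewrite ?ai ?ltnn //.
  by rewrite (bihomog_eps0 wh); apply/rowP => b; rewrite !ord1 !mxE e0 ?ai.
exists psi; split=> [a||a ai]; first by have [] := psiP a.
  by apply/row_matrixP => a; rewrite row_mul; have [] := psiP a.
(* Row [a] of [tdiff G1] only involves basis elements of homological degree at most [i], where [psi]
   and [phi] agree. *)
have -> : row a (tdiff G1) *m psi = row a (tdiff G1) *m phi.
  apply/rowP => c; rewrite !mxE; apply: eq_bigr => b _.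
  rewrite mxE; have [bi|bi] := leqP (hdeg b) i.
    by have [_ _ /(_ bi)/rowP/(_ c) + _] := psiP b; rewrite !mxE => ->.
  by rewrite D0 ?mul0r // (leq_trans ai).
have [_ _ lt_i eq_i] := psiP a.
move: ai; rewrite leq_eqVlt => /predU1P[/eq_i //|].
by rewrite ltnS => ai; rewrite lt_i // phiD.
Qed.

(** Of a preimage, [teps] sees only the components in homological degree 0, and [tdiff] kills
    those. *)
Lemma teps_onto_cycle I (G : total_resolution I) p : I p ->
  exists2 v : 'rV[S]_(trk G), p = (v *m teps G) 0 0 & v *m tdiff G = 0.
Proof.
move=> /(teps_onto G)[v ->]; exists (\row_b if hdeg b == 0%N then v 0 b else 0).
  rewrite !mxE; apply: eq_bigr => b _; rewrite mxE.
  have [->|/mpoly_neq0P[m /teps_deg[-> _]]] // := eqVneq (teps G b 0) 0.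
  by rewrite !mulr0.
apply/rowP => c; rewrite !mxE big1 // => b _; rewrite mxE.
have [->|/mpoly_neq0P[m /tdiff_deg[-> _]]] := eqVneq (tdiff G b c) 0.
  by rewrite mulr0.
by rewrite mul0r.
Qed.


(* The mapping cone of [(x, - phi) : G1(-1) -> G1 (+) G2(-1)], a lift of the
   first map of the exact sequence [0 -> I1(-1) -> I1 (+) I2(-1) -> I -> 0]. *)
Section Cone.
Variables (I1 I2 I : S -> Prop) (x : 'I_n).
Variables (G1 : total_resolution I1) (G2 : total_resolution I2).
Variable phi : 'M[S]_(trk G1, trk G2).
Hypothesis IE :
  forall p, I p <-> exists a b, [/\ I1 a, I2 b & p = a + 'X_x * b].
Hypothesis colonx : forall b, I1 ('X_x * b) -> I1 b.
Hypothesis phi_deg : forall a, bihomog (hdeg a) (tdeg a) (row a phi).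
Hypothesis phi_eps : phi *m teps G2 = teps G1.
Hypothesis phi_diff : phi *m tdiff G2 = tdiff G1 *m phi.

Local Notation N := (trk G1 + (trk G1 + trk G2))%N.

Definition cone_hdeg : 'I_N -> nat :=
  case_split (fun a => (hdeg a).+1)
    (case_split (fun a : 'I_(trk G1) => hdeg a)
       (fun b : 'I_(trk G2) => hdeg b)).

Definition cone_tdeg : 'I_N -> int :=
  case_split (fun a => tdeg a + 1)
    (case_split (fun a : 'I_(trk G1) => tdeg a)
       (fun b : 'I_(trk G2) => tdeg b + 1)).

Definition cone_eps : 'cV[S]_N :=
  col_mx 0 (col_mx (teps G1) ('X_x *: teps G2)).

Definition cone_diff : 'M[S]_N :=
  block_mx (- tdiff G1) (row_mx ('X_x)%:M (- phi))
           0 (block_mx (tdiff G1) 0 0 (tdiff G2)).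

Lemma mcoeffXM_neq0 p m : ('X_x * p)@_m != 0 ->
  exists2 m', m = (U_(x) + m')%MM & p@_m' != 0.
Proof.
rewrite -mcoeff_msupp mulrC (perm_mem (msuppMX p U_(x)%MM)) => /mapP[m' pm' ->].
by exists m'; rewrite // -mcoeff_msupp.
Qed.

Lemma cone_eps_deg a m : (cone_eps a 0)@_m != 0 ->
  cone_hdeg a = 0%N /\ cone_tdeg a = (mdeg m)%:Z.
Proof.
rewrite /cone_eps /cone_hdeg /cone_tdeg.
case: (split_ordP a) => {}a ->; first by rewrite col_mxEu mxE mcoeff0 eqxx.
rewrite col_mxEd; case: (split_ordP a) => {}a ->; rewrite ?case_splitE.
  by rewrite col_mxEu => /teps_deg.
rewrite col_mxEd mxE => /mcoeffXM_neq0[m' ->] /teps_deg[-> ->].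
by rewrite mdegD mdeg1 PoszD addrC.
Qed.

Lemma cone_diff_deg a b m : (cone_diff a b)@_m != 0 ->
  cone_hdeg a = (cone_hdeg b).+1 /\ cone_tdeg a = (mdeg m)%:Z + cone_tdeg b.
Proof.
rewrite /cone_diff /cone_hdeg /cone_tdeg.
case: (split_ordP a) => {}a ->; case: (split_ordP b) => {}b ->;
  rewrite ?case_splitE ?block_mxEul ?block_mxEur ?block_mxEdl ?block_mxEdr.
- by rewrite mxE mcoeffN oppr_eq0 => /tdiff_deg[-> ->]; rewrite addrA.
- case: (split_ordP b) => {}b ->; rewrite ?case_splitE ?row_mxEl ?row_mxEr.
    rewrite mxE; case: (a =P b) => [->|_]; last by rewrite mulr0n mcoeff0 eqxx.
    rewrite mulr1n mcoeffX.
    case: (U_(x)%MM =P m) => [<- _|_]; last by rewrite eqxx.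
    by rewrite mdeg1 addrC.
  rewrite mxE mcoeffN oppr_eq0 => phim; have [|hb tb] := @phi_deg a b m.
    by rewrite mxE.
  by rewrite hb -tb addrA.
- by rewrite mxE mcoeff0 eqxx.
case: (split_ordP a) => {}a ->; case: (split_ordP b) => {}b ->;
  rewrite ?case_splitE ?block_mxEul ?block_mxEur ?block_mxEdl ?block_mxEdr.
- exact: tdiff_deg.
- by rewrite mxE mcoeff0 eqxx.
- by rewrite mxE mcoeff0 eqxx.
- by move=> /tdiff_deg[-> ->]; rewrite addrA.
Qed.

Lemma cone_mulE (v1 v2 : 'rV[S]_(trk G1)) (v3 : 'rV[S]_(trk G2)) :
  row_mx v1 (row_mx v2 v3) *m cone_diff =
  row_mx (- (v1 *m tdiff G1))
    (row_mx ('X_x *: v1 + v2 *m tdiff G1) (v3 *m tdiff G2 - v1 *m phi)).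
Proof.
rewrite mul_row_block mulmx0 addr0 mulmxN mul_mx_row mul_row_block !mulmx0.
by rewrite addr0 add0r add_row_mx mul_mx_scalar mulmxN [- _ + _]addrC.
Qed.

Lemma cone_epsE (v1 v2 : 'rV[S]_(trk G1)) (v3 : 'rV[S]_(trk G2)) :
  row_mx v1 (row_mx v2 v3) *m cone_eps =
  v2 *m teps G1 + 'X_x *: (v3 *m teps G2).
Proof. by rewrite !mul_row_col mulmx0 add0r -scalemxAr. Qed.

Lemma cone_diff_eps : cone_diff *m cone_eps = 0.
Proof.
apply/row_matrixP => a; rewrite row_mul row0 rowE -[delta_mx 0 a]hsubmxK.
rewrite -[rsubmx _]hsubmxK cone_mulE cone_epsE.
rewrite mulmxBl mulmxDl -!mulmxA tdiff_eps !mulmx0 tdiff_eps mulmx0 phi_eps.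
by rewrite addr0 sub0r scalerN -scalemxAl subrr.
Qed.

Lemma cone_diff_sq : cone_diff *m cone_diff = 0.
Proof.
apply/row_matrixP => a; rewrite row_mul row0 rowE -[delta_mx 0 a]hsubmxK.
rewrite -[rsubmx _]hsubmxK !cone_mulE.
rewrite mulNmx mulmxBl mulmxDl mulNmx -!mulmxA !tdiff_sq !mulmx0 phi_diff.
by rewrite -scalemxAl scalerN addr0 addNr sub0r !oppr0 opprK addNr !row_mx0.
Qed.

Lemma cone_eps_onto p : I p <-> exists v : 'rV[S]_N, p = (v *m cone_eps) 0 0.
Proof.
split=> [/IE[a [b [/(teps_onto G1)[v ->] /(teps_onto G2)[w ->] ->]]]|[v ->]].
  by exists (row_mx 0 (row_mx v w)); rewrite cone_epsE !mxE.
rewrite -[v]hsubmxK -[rsubmx v]hsubmxK cone_epsE mxE; apply/IE.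
exists ((lsubmx (rsubmx v) *m teps G1) 0 0).
exists ((rsubmx (rsubmx v) *m teps G2) 0 0).
split; last by congr (_ + _); rewrite mxE.
  by apply/(teps_onto G1); eexists.
by apply/(teps_onto G2); eexists.
Qed.

Lemma scaleX_eq0 (v : 'cV[S]_1) : 'X_x *: v = 0 -> v = 0.
Proof.
have X0 : 'X_x != 0 :> S.
  by apply/mpoly_neq0P; exists U_(x)%MM; rewrite mcoeffX eqxx oner_eq0.
move=> /colP/(_ 0); rewrite !mxE => /eqP; rewrite mulf_eq0 (negPf X0) /=.
by move=> /eqP v0; apply/colP => i; rewrite !ord1 mxE.
Qed.

(** Diagram chase: [v1] is a boundary in [G1]. After correcting for it, the augmentation of the
    third component lies in [I1] by [colonx]; lifting it to a cycle [y] of [G1] lets the last two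
    components be treated separately. *)
Lemma cone_exact (v : 'rV[S]_N) : v *m cone_diff = 0 -> v *m cone_eps = 0 ->
  exists w, v = w *m cone_diff.
Proof.
rewrite -[v]hsubmxK -[rsubmx v]hsubmxK.
move: (lsubmx v) (lsubmx (rsubmx v)) (rsubmx (rsubmx v)) => v1 v2 v3 {v}.
rewrite cone_mulE cone_epsE => /eqP; rewrite !row_mx_eq0 oppr_eq0.
move=> /and3P[/eqP v1D /eqP v2D /eqP v3D] veps.
have [|u1 v1E] := texact v1D.
  apply: scaleX_eq0; rewrite scalemxAl.
  have -> : 'X_x *: v1 = - (v2 *m tdiff G1) by apply/eqP; rewrite -addr_eq0 v2D.
  by rewrite mulNmx -mulmxA tdiff_eps mulmx0 oppr0.
(* Subtracting the boundary of [(- u1, 0, 0)] from [v] leaves [(0, v2', v3')]. *)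
pose v3' := v3 - u1 *m phi; pose v2' := v2 + 'X_x *: u1.
have v2'D : v2' *m tdiff G1 = 0.
  by rewrite mulmxDl -scalemxAl -v1E addrC v2D.
have v3'D : v3' *m tdiff G2 = 0.
  by rewrite mulmxBl -mulmxA phi_diff mulmxA -v1E v3D.
have veps' : v2' *m teps G1 + 'X_x *: (v3' *m teps G2) = 0.
  rewrite mulmxDl mulmxBl -mulmxA phi_eps scalerBr -scalemxAl addrACA veps.
  by rewrite subrr addr0.
have [|y yE yD] := @teps_onto_cycle _ G1 ((v3' *m teps G2) 0 0).
  apply: colonx; apply/(teps_onto G1); exists (- v2').
  rewrite mulNmx; move/eqP: veps'; rewrite addrC addr_eq0 => /eqP/colP/(_ 0).
  by rewrite mxE => ->.
have {}yE : v3' *m teps G2 = y *m teps G1.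
  by apply/colP => i; rewrite !ord1 yE.
have [||u2 u2E] := @texact _ G1 (v2' + 'X_x *: y).
- by rewrite mulmxDl v2'D -scalemxAl yD scaler0 addr0.
- by rewrite mulmxDl -scalemxAl -yE veps'.
have [||u3 u3E] := @texact _ G2 (v3' - y *m phi).
- by rewrite mulmxBl v3'D -mulmxA phi_diff mulmxA yD mul0mx subr0.
- by rewrite mulmxBl yE -mulmxA phi_eps subrr.
(* The first component gathers both corrections; its sign comes from the block [- tdiff G1] of
   [cone_diff]. *)
exists (row_mx (- (u1 + y)) (row_mx u2 u3)); rewrite cone_mulE -u2E -u3E.
congr row_mx; last congr row_mx.
- by rewrite mulNmx opprK mulmxDl yD addr0.
- by rewrite /v2' -[v2 + _ + _]addrA -scalerDr scalerN [v2 + _]addrC addKr.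
- by rewrite /v3' mulNmx opprK mulmxDl -[v3 - _ - _]addrA -opprD subrK.
Qed.

Definition cone : total_resolution I :=
  @TotalResolution I N cone_hdeg cone_tdeg cone_eps cone_diff cone_eps_deg
    cone_diff_deg cone_diff_eps cone_diff_sq cone_eps_onto cone_exact.

(** The degree shift by one is offset in the first copy of [G1] by the shift of [hdeg], and in [G2]
    by a bound that is better by one. *)
Lemma cone_tdeg_le (r : nat) :
    (forall a : 'I_(trk G1), tdeg a <= (hdeg a + r.+1)%:Z) ->
    (forall b : 'I_(trk G2), tdeg b <= (hdeg b + r)%:Z) ->
  forall s : 'I_(trk cone), tdeg s <= (hdeg s + r.+1)%:Z.
Proof.
move=> le1 le2 s; rewrite /= /cone_tdeg /cone_hdeg.
case: (split_ordP s) => {}s ->; rewrite ?case_splitE.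
  by have := le1 s; lia.
case: (split_ordP s) => {}s ->; rewrite ?case_splitE //.
by have := le2 s; lia.
Qed.

End Cone.

(** * Monomial ideals of complexes restricted to a vertex set *)

Definition msupport (V : {set 'I_n}) (m : 'X_{1..n}) : {set 'I_n} :=
  [set i in V | m i != 0%N].

(* The Stanley-Reisner ideal of the restriction of [Delta] to [V], extended to
   the full polynomial ring. *)
Definition monomial_ideal (Delta : {set 'I_n} -> Prop) (V : {set 'I_n}) p :=
  forall m, p@_m != 0 -> ~ Delta (msupport V m).

Definition hereditary (Delta : {set 'I_n} -> Prop) : Prop :=
  forall F F' : {set 'I_n}, F' \subset F -> Delta F -> Delta F'.

(** On sets avoiding [x] this is the usual link. *)
Definition link (Delta : {set 'I_n} -> Prop) (x : 'I_n) (F : {set 'I_n}) :=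
  Delta (x |: F).

Lemma msupportDx (V : {set 'I_n}) x m : x \in V ->
  msupport V (U_(x) + m)%MM = x |: msupport (V :\ x) m.
Proof.
move=> xV; apply/setP => i; rewrite !inE mnmDE mnm1E.
by case: (eqVneq i x) => [->|ix]; rewrite ?eqxx ?xV // eq_sym (negPf ix).
Qed.

Lemma msupport_notin (V : {set 'I_n}) x m : x \notin V ->
  msupport V (U_(x) + m)%MM = msupport V m.
Proof.
move=> xV; apply/setP => i; rewrite !inE mnmDE mnm1E.
by case: (eqVneq x i) => [<-|//]; rewrite (negPf xV).
Qed.

Section Split.
Variables (Delta : {set 'I_n} -> Prop) (V : {set 'I_n}) (x : 'I_n).
Hypothesis hD : hereditary Delta.

Lemma monomial_ideal_link p :
  monomial_ideal Delta (V :\ x) p -> monomial_ideal (link Delta x) (V :\ x) p.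
Proof. by move=> Dp m /Dp nD D; apply: nD; apply: hD D; apply: subsetUr. Qed.

(** [x] lies outside [V :\ x], so multiplication by ['X_x] changes no support. *)
Lemma monomial_ideal_colon p :
  monomial_ideal Delta (V :\ x) ('X_x * p) -> monomial_ideal Delta (V :\ x) p.
Proof.
move=> Dp m pm; rewrite -(@msupport_notin _ x) ?setD11 //; apply: Dp.
by rewrite mulrC mcoeffMX.
Qed.

(** Monomials of [p] free of ['X_x] make up [a], and the others, divided by ['X_x], make up [b]. *)
Lemma monomial_ideal_split p : x \in V ->
  monomial_ideal Delta V p <->
  exists a b, [/\ monomial_ideal Delta (V :\ x) a,
                  monomial_ideal (link Delta x) (V :\ x) b & p = a + 'X_x * b].
Proof.
move=> xV; split=> [Dp|[a [b [Da Db ->]]] m]; last first.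
  rewrite mcoeffD => nz.
  have [am|am] := eqVneq a@_m 0.
    move: nz; rewrite am add0r => /mcoeffXM_neq0[m' -> /Db].
    by rewrite msupportDx.
  move=> Dm; apply: (Da m am); apply: hD Dm; apply/subsetP => i.
  by rewrite !inE => /andP[/andP[_ ->]].
pose c := \sum_(m <- msupp p | m x != 0%N) p@_m *: 'X_[(m - U_(x))] : S.
have Ux (m : 'X_{1..n}) : m x != 0%N -> (U_(x) + (m - U_(x)))%MM = m.
  move=> mx; apply/mnmP => i; rewrite !mnmE.
  by case: eqP => [<-|_] //=; rewrite subnKC // lt0n.
exists (mfilter (fun m => m x == 0%N) p), c; split=> [m|m|].
- rewrite mcoeff_mfilter; case: ifP; last by rewrite eqxx.
  move=> mx /Dp; congr (~ Delta _); apply/setP => i; rewrite !inE.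
  by case: (eqVneq i x) => [->|//]; rewrite mx andbF.
- rewrite raddf_sum /= => nz.
  have [m' mx m'm] : exists2 m' : 'X_{1..n}, p@_m' != 0 /\ m' x != 0%N
      & (m' - U_(x))%MM = m.
    have [//|no] := pselect (exists2 m' : 'X_{1..n}, p@_m' != 0 /\ m' x != 0%N
      & (m' - U_(x))%MM = m).
    case/eqP: nz; rewrite big1_seq // => m' /andP[m'x].
    rewrite mcoeff_msupp => pm'.
    rewrite mcoeffZ mcoeffX; case: eqP => [m'm|_]; last by rewrite mulr0.
    by case: no; exists m'.
  by rewrite /link -msupportDx // -m'm Ux; case: mx => // /Dp.
rewrite {1}(mpolyE p) (bigID (fun m : 'X_{1..n} => m x == 0%N)) /=.
congr (_ + _).
rewrite mulr_sumr; apply: eq_bigr => m mx.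
by rewrite -scalerAr -mpolyXD Ux.
Qed.

End Split.

(** * Resolutions of monomial ideals by induction on the vertex set *)

Lemma zero_resolution I : (forall p, I p <-> p = 0) ->
  exists G : total_resolution I, trk G = 0%N.
Proof.
move=> I0; unshelve eexists
  (@TotalResolution I 0 (fun=> 0%N) (fun=> 0) 0 0 _ _ _ _ _ _) => //.
- by case.
- by case.
- by rewrite mul0mx.
- by rewrite mul0mx.
- move=> p; split=> [/I0 ->|[v ->]]; first by exists 0; rewrite mulmx0 mxE.
  by apply/I0; rewrite mulmx0 mxE.
- by move=> v _ _; exists 0; rewrite mulmx0 [v]thinmx0.
Qed.

Lemma unit_resolution I : (forall p, I p) ->
  exists G : total_resolution I, forall a : 'I_(trk G), tdeg a = 0.
Proof.
move=> I1; unshelve eexists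
  (@TotalResolution I 1 (fun=> 0%N) (fun=> 0) 1%:M 0 _ _ _ _ _ _) => //.
- move=> a m; rewrite !ord1 mxE eqxx mulr1n mcoeff1.
  by case: (eqVneq m 0%MM) => [->|_]; rewrite ?mdeg0 ?eqxx.
- by move=> a b m; rewrite mxE mcoeff0 eqxx.
- by rewrite mul0mx.
- by rewrite mul0mx.
- by move=> p; split=> // _; exists p%:M; rewrite mulmx1 mxE eqxx mulr1n.
- by move=> v _; rewrite mulmx1 => ->; exists 0; rewrite mul0mx.
Qed.

(** Each step takes the cone built from the deletion and the link of a vertex. The strict bound on
    faces admits [r = 0], the void complex, whose ideal is the whole ring. *)
Lemma monomial_resolution (Delta : {set 'I_n} -> Prop) (V : {set 'I_n})
    (r : nat) :
    hereditary Delta ->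
    (forall F : {set 'I_n}, F \subset V -> Delta F -> (#|F| < r)%N) ->
  exists G : total_resolution (monomial_ideal Delta V),
    forall a : 'I_(trk G), tdeg a <= (hdeg a + r)%:Z.
Proof.
have [c] := ubnP #|V|; elim: c V Delta r => // c IHc V Delta r Vc hD Dr.
have [D0|nD0] := pselect (Delta set0); last first.
  have [p m _ Dm|G G0] := @unit_resolution (monomial_ideal Delta V).
    by apply: nD0; apply: hD Dm; apply: sub0set.
  by exists G => a; rewrite G0.
case: r Dr => [/(_ _ (sub0set V) D0)|r Dr] //.
(* With no vertices left and the empty set a face, the ideal is zero. *)
have [V0|[x xV]] := set_0Vmem V.
  have [p|G G0] := @zero_resolution (monomial_ideal Delta V).
    split=> [Dp|-> m]; last by rewrite mcoeff0 eqxx.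
    apply/eqP/negPn/negP => /mpoly_neq0P[m /Dp[]].
    by suff -> : msupport V m = set0 by []; apply/setP => i; rewrite V0 !inE.
  by exists G => a; have := leq_ltn_trans (leq0n a) (ltn_ord a); rewrite G0.
have V'c : (#|V :\ x| < c)%N by move: Vc; rewrite (cardsD1 x) xV.
have [||G1 G1r] := IHc (V :\ x) Delta r.+1 V'c => //.
  by move=> F FV; apply: Dr; apply: subset_trans FV (subD1set _ _).
(* Adding [x] to a face of the link gives a face of [Delta] with one more element, so the bound
   drops from [r.+1] to [r]. *)
have [||G2 G2r] := IHc (V :\ x) (link Delta x) r V'c.
- by move=> F F' FF'; apply: hD; apply: setUS.
- move=> F FV /Dr; rewrite subUset sub1set xV (subset_trans FV) ?subD1set //.
  have /negPf xF : x \notin F by apply/negP => /(subsetP FV); rewrite setD11.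
  by rewrite cardsU1 xF => /(_ isT).
have [phi [phi_deg phi_eps phi_diff]] :=
  total_lift G1 G2 (@monomial_ideal_link Delta V x hD).
exists (cone (fun p => monomial_ideal_split hD p xV)
  (@monomial_ideal_colon Delta V x) phi_deg phi_eps phi_diff).
exact: cone_tdeg_le.
Qed.

(** * Stanley--Reisner ideals and the regularity bound *)

Lemma prod_mpolyX (F : {set 'I_n}) :
  \prod_(i in F) 'X_i = 'X_[(\sum_(i in F) U_(i))] :> S.
Proof. by apply/esym/big_morph; [exact: mpolyXD|exact: mpolyX0]. Qed.

Lemma mnm_sum_set (F : {set 'I_n}) j : (\sum_(i in F) U_(i))%MM j = (j \in F).
Proof.
rewrite mnm_sumE; under eq_bigr do rewrite mnm1E.
have [jF|jF] := boolP (j \in F).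
  rewrite (bigD1 j) //= eqxx big1 ?addn0 // => i /andP[_ /negPf ij].
  by rewrite ij.
by rewrite big1 // => i iF; case: eqP => // ij; rewrite -ij iF in jF.
Qed.

(** A monomial is a multiple of the squarefree monomial of its support, which is a generator if the
    support is not a face. Conversely, heredity keeps multiples of generators in the monomial
    ideal. *)
Lemma stanley_reisnerE (Delta : {set 'I_n} -> Prop) : hereditary Delta ->
  stanley_reisner k Delta = monomial_ideal Delta [set: 'I_n].
Proof.
move=> hD; apply/funext => p; apply/propext; split=> [[s sD ->] m|Dp].
  rewrite raddf_sum /= => nz.
  have [cg cgs {}nz] : exists2 cg, cg \in s & (cg.1 * cg.2)@_m != 0.
    apply/hasP; apply: contraNT nz => /hasPn no.
    rewrite big1_seq // => cg /= cgs.
    by apply/eqP; move: (no _ cgs); rewrite negbK.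
  have [F nDF gE] := sD _ cgs; move: nz; rewrite gE prod_mpolyX -mcoeff_msupp.
  rewrite (perm_mem (msuppMX _ _)) => /mapP[m' _ ->] Dm; apply: nDF.
  apply: hD Dm; apply/subsetP => i iF.
  by rewrite !inE mnmDE mnm_sum_set iF.
pose F m := msupport [set: 'I_n] m.
exists [seq (p@_m *: 'X_[(m - \sum_(i in F m) U_(i))],
             \prod_(i in F m) 'X_i) | m <- msupp p].
  move=> cg /mapP[m mp ->]; exists (F m) => //.
  by apply: Dp; rewrite -mcoeff_msupp.
rewrite big_map [LHS]mpolyE; apply: eq_bigr => m _ /=.
rewrite prod_mpolyX -scalerAl -mpolyXD submK //.
by apply/mnm_lepP => i; rewrite mnm_sum_set !inE; case: (m i).
Qed.

(** The value [+oo] is excluded: a nonempty set of integers bounded above has a maximum, found by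
    minimizing the distance [d] to [r]. *)
Lemma max_ext_le (A : int -> Prop) (r : int) :
  (forall j, A j -> j <= r) -> (max_ext A <= r%:E)%E.
Proof.
move=> Ar; rewrite /max_ext; case: pselect => [ex|noM].
  by rewrite lee_fin; case: (cid ex) => /= j [/Ar].
case: (pselect (exists j, A j)) => [[j Aj]|noA] /=; last exact: leNye.
case: noM; have exB : exists d : nat, `[< A (r - d%:Z) >].
  by exists `|r - j|%N; apply/asboolP; rewrite gez0_abs ?subr_ge0 ?Ar // subKr.
have [d /asboolP Ad dmin] := ex_minnP exB.
exists (r - d%:Z); split=> // i Ai.
have /dmin : `[< A (r - `|r - i|%N%:Z) >].
  by apply/asboolP; rewrite gez0_abs ?subr_ge0 ?Ar // subKr.
by have := Ar _ Ai; lia.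
Qed.

Lemma reg_stanley_reisner_le (Delta : {set 'I_n} -> Prop) (d : nat) :
    hereditary Delta -> (forall F : {set 'I_n}, Delta F -> (#|F| <= d)%N) ->
  (reg (stanley_reisner k Delta) <= (d.+1%:Z)%:E)%E.
Proof.
move=> hD Dd; apply: max_ext_le => j [i [F nz]].
have [//|F' _ /Dd //|] := @monomial_resolution Delta [set: 'I_n] d.+1.
rewrite -stanley_reisnerE // => G Gd.
rewrite leNgt; apply/negP => ltj.
apply: (homology_vanish (G := G) (r := d.+1%:Z) _ _ nz).
- by move=> b; rewrite -PoszD; exact: Gd.
- by rewrite ltrD2l.
Qed.

End Resolutions.

(** * Subword complexes *)

Section SubwordComplex.
Variables (W : groupType) (Sigma : {pred W}) (n : nat) (Q : n.-tuple W) (w : W).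

Lemma subword_complex_hereditary : hereditary (subword_complex Sigma Q w).
Proof.
move=> F F' F'F [P [P' P'P Pw] FE]; exists (~: F'); last by rewrite setCK.
exists P' => //; apply: subset_trans P'P _.
by rewrite -(setCK P) -FE setCS.
Qed.

(** The complement of a face contains a subword representing [w], which has [coxeter_length Sigma w]
    positions. *)
Lemma subword_complex_card F :
  subword_complex Sigma Q w F -> (#|F| <= n - coxeter_length Sigma w)%N.
Proof.
move=> [P [P' P'P [_ <-]] ->]; rewrite cardsCs setCK card_ord.
exact/leq_sub2l/subset_leq_card.
Qed.

End SubwordComplex.

Theorem corollary4p1p16 (W : groupType) (Sigma : {pred W})
    (hW : coxeter_system Sigma)
    (n : nat) (Q : n.-tuple W) (hQ : {subset Q <= Sigma})
    (pi : W) (hpi : contains Sigma Q [set: 'I_n] pi)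
    (k : fieldType) :
  (reg (stanley_reisner k (subword_complex Sigma Q pi))
     <= (n%:Z - (coxeter_length Sigma pi)%:Z + 1)%:E)%E.
Proof.
(* Since [Q] contains [pi], the truncated subtraction agrees with the one in [int]. *)
have ln : (coxeter_length Sigma pi <= n)%N.
  by case: hpi => P _ [_ <-]; rewrite -[leqRHS]card_ord max_card.
have -> : n%:Z - (coxeter_length Sigma pi)%:Z + 1 =
    (n - coxeter_length Sigma pi).+1%:Z by lia.
apply: reg_stanley_reisner_le; first exact: subword_complex_hereditary.
exact: subword_complex_card.
Qed.
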